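(* Let $f\colon T_1\to T_2$ be a homomorphism of complex tori having finite kernel and let $g_1=\dim T_1\ge 1$. Then $$e(f)=d_{2g_1}(f)\quad\text{and}\quad \deg(f)=e(f)\cdot\delta_{2g_1-1}(f).$$ Moreover, if $f$ is an isogeny and $f'$ is its inverse isogeny, then the type of $f'$ is $$(d_1(f'),\ldots,d_{2g_1}(f'))=\left(1,\frac{d_{2g_1}(f)}{d_{2g_1-1}(f)},\frac{d_{2g_1}(f)}{d_{2g_1-2}(f)},\ldots,\frac{d_{2g_1}(f)}{d_1(f)}\right).$$ In particular, $e(f)=d_1(f)\cdot e(f')$.
   Context: A complex torus of dimension $g$ is a quotient $T=V/L$ of a complex vector space $V$ of dimension $g$ by a lattice $L$ (a discrete subgroup of $V$ of rank $2g$ generating $V$ as a real vector space). A homomorphism $f\colon T_1=V_1/L_1\to T_2=V_2/L_2$ of complex tori (a holomorphic group homomorphism) is induced by a $\mathbb C$-linear map $\rho_a(f)\colon V_1\to V_2$ with $\rho_a(f)(L_1)\subseteq L_2$ (the analytic representation); its restriction $\rho_r(f)\colon L_1\to L_2$ is the rational representation. $[\rho_r(f)]$ denotes the integral matrix of $\rho_r(f)$, of size $2\dim T_2\times 2\dim T_1$, with respect to chosen $\mathbb Z$-bases of $L_1$ and $L_2$. For $k\ge 1$, the $k$-th determinantal divisor $\delta_k(f)$ is the (positive) greatest common divisor of the minors of order $k$ of $[\rho_r(f)]$ if at least one of them is non-zero, and $\delta_k(f)=0$ otherwise; also $\delta_0(f):=1$. These do not depend on the choice of bases. If $r$ is the rank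 of $[\rho_r(f)]$, set $d_k(f):=\delta_k(f)/\delta_{k-1}(f)\in\mathbb Z_{>0}$ for $1\le k\le r$. The type of $f$ is the vector $(d_1(f),\ldots,d_r(f))$. If $f$ has finite kernel, then $r=2\dim T_1$. The degree $\deg(f)$ of a homomorphism with finite kernel is the order of $\ker f$, and its exponent $e(f)$ is the smallest $n\in\mathbb Z_{>0}$ such that $nt=0$ for all $t\in\ker f$. An isogeny is a surjective homomorphism with finite kernel. The inverse isogeny of an isogeny $f\colon T_1\to T_2$ is the isogeny $f'\colon T_2\to T_1$ such that $f\circ f'$ and $f'\circ f$ are multiplication by $e(f)$ on $T_2$ and $T_1$ respectively. *)

(* Defs.v *)
From HB Require Import structures.
From mathcomp Require Import all_boot all_order all_algebra.
From mathcomp Require Import generic_quotient ring_quotient finmap.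
From mathcomp Require Import all_classical all_reals all_analysis.
From mathcomp Require Import complex.
Set Implicit Arguments. Unset Strict Implicit. Unset Printing Implicit Defensive.
Import Order.TTheory GRing.Theory Num.Theory.
Import numFieldNormedType.Exports.
Local Open Scope classical_set_scope.
Local Open Scope ring_scope.
Local Open Scope complex_scope.
Local Open Scope quotient_scope.

(* A finite-dimensional complex vector space with its usual topology is encoded
   as a finite-dimensional normed space; all norms on it are equivalent, so the
   norm only serves to fix that topology. *)
#[short(type="normedVectType")]
HB.structure Definition NormedVector (K : numFieldType) :=
  { V of NormedModule K V & Vector K V }.

(* Triggers the join instance on nonempty matrices. *)
HB.instance Definition _ (K : numFieldType) m n :=
  GRing.Zmodule.copy 'M[K]_(m.+1, n.+1) 'M[K]_(m.+1, n.+1).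

Definition is_zbasis (V : zmodType) (L : {pred V}) n (b : 'I_n -> V) : Prop :=
  (forall i, b i \in L) /\
  forall x, x \in L -> exists! c : 'rV[int]_n, x = \sum_i b i *~ c 0 i.

Record is_lattice (R : realType) (V : normedVectType R[i]) (L : zmodClosed V) :
    Prop := IsLattice {
  lattice_discrete : forall x, x \in L -> isolated [set` L] x;
  lattice_rank : exists b : 'I_(2 * \dim {:V}) -> V, is_zbasis L b;
  lattice_span : forall v : V, exists n (l : 'I_n -> V) (c : 'I_n -> R),
    (forall i, l i \in L) /\ v = \sum_i (c i)%:C *: l i }.

Record complexTorus (R : realType) := ComplexTorus {
  torus_space : normedVectType R[i];
  torus_lattice : zmodClosed torus_space;
  torus_latticeP : is_lattice torus_lattice }.

Section Torus.
Variable R : realType.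
Implicit Types T : complexTorus R.

Definition torus_quot T : zmodType := Quotient.quot (torus_lattice T).
Coercion torus_quot : complexTorus >-> GRing.Zmodule.type.

Definition torus_pi T (v : torus_space T) : T :=
  \pi_(Quotient.quot (torus_lattice T)) v.

Definition torus_dim T : nat := \dim {: torus_space T}.

Record latticeBasis T := LatticeBasis {
  lattice_basis :> 'I_(2 * torus_dim T) -> torus_space T;
  lattice_basisP : is_zbasis (torus_lattice T) lattice_basis }.

Lemma torus_piB T : zmod_morphism (@torus_pi T).
Proof. exact: pi_is_zmod_morphism. Qed.

HB.instance Definition _ T :=
  GRing.isZmodMorphism.Build _ _ (@torus_pi T) (@torus_piB T).

Lemma torus_pi_eq0 T (v : torus_space T) :
  (torus_pi v == 0) = (v \in torus_lattice T).
Proof. by rewrite -(raddf0 (@torus_pi T)) /torus_pi -Quotient.idealrBE subr0. Qed.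

(* The charts of V / L are the local inverses of the projection V -> V / L, so
   a map from V1 / L1 to V2 / L2 is holomorphic iff, composed with the
   projection of V1, it lifts around every point to a map into V2 that is
   complex differentiable on a neighbourhood of that point. *)
Record torusHom T1 T2 := TorusHom {
  hom_fun :> {additive T1 -> T2};
  hom_holomorphic : forall v : torus_space T1,
    exists h : torus_space T1 -> torus_space T2,
      \forall u \near v,
        differentiable h u /\ torus_pi (h u) = hom_fun (torus_pi u) }.

End Torus.

Lemma complex_norm_lt_nat (R : realType) (V : normedVectType R[i]) (v : V) :
  exists n, `|v| < n%:R :> R[i].
Proof.
have [r rE] : exists r : R, `|v| = r%:C :> R[i].
  have := normr_ge0 v; case: `|v| => a b; rewrite lecE /= => /andP[/eqP b0 _].
  by exists a; rewrite b0.
exists (Num.truncn r).+1; rewrite rE -(rmorph_nat (real_complex R)) ltcR.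
exact: truncnS_gt.
Qed.

Lemma small_scale (R : realType) (V : normedVectType R[i]) (v : V) (d : R[i]) :
  0 < d -> exists n, `|(2 ^- n) *: v| < d.
Proof.
move=> d0; have [n vn] := complex_norm_lt_nat (d^-1 *: v).
exists n; rewrite normrZ gtr0_norm ?invr_gt0 ?exprn_gt0 //.
rewrite mulrC ltr_pdivrMr ?exprn_gt0 //.
move: vn; rewrite normrZ gtr0_norm ?invr_gt0 // mulrC ltr_pdivrMr // => vn.
apply: (lt_trans vn); rewrite mulrC ltr_pM2l // -natrX ltr_nat.
exact: ltn_expl.
Qed.

Lemma lattice_gap (R : realType) (T : complexTorus R) :
  exists2 e : R[i], 0 < e &
    forall x : torus_space T, x \in torus_lattice T -> `|x| < e -> x = 0.
Proof.
have [_ [U U0 UL]] := lattice_discrete (torus_latticeP T) (rpred0 _).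
have [e e0 eU] := (iffLR (nbhs_normP _ _)) U0.
exists e => // x xL xe; have : (U `&` [set` torus_lattice T]) x.
  by split => //; apply: eU; rewrite /= sub0r normrN.
by rewrite UL.
Qed.

Lemma analytic_rep_exists (R : realType) (T1 T2 : complexTorus R) (f : torusHom T1 T2) :
  exists F : {linear torus_space T1 -> torus_space T2},
    forall v, f (torus_pi v) = torus_pi (F v).
Proof.
have [h hP] := hom_holomorphic f 0.
have [dh] := nbhs_singleton hP; rewrite !raddf0 => h0.
have [e e0 eL] := lattice_gap T2.
have [Dc hD] := (iffLR (diff_locallyP _ _)) dh.
pose D : {linear torus_space T1 -> torus_space T2} := 'd h 0.
exists D.
have hr := (iffLR (eqaddoP _ _ _ _)) hD.
pose k u := h u - h 0.
pose r u := k u - D u.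
have pik u : torus_pi (k u) = torus_pi (h u) by rewrite raddfB /= h0 subr0.
have [d d0 dP] : exists2 d : R[i], 0 < d & forall u, `|u| < d ->
    `|k u| < e / 3 /\ torus_pi (k u) = f (torus_pi u).
  have hc : {for 0, continuous h} by exact: differentiable_continuous.
  have e3 : 0 < e / 3 by rewrite divr_gt0 // ltr0n.
  have hN : \forall t \near nbhs (0 : torus_space T1), `|h 0 - h t| < e / 3.
    by move/cvgrPdist_lt: hc; apply.
  have [d d0 dU] := (iffLR (nbhs_normP _ _)) (filterI hN hP).
  exists d => // u ud; have [|h1 [_ h2]] := dU u; first by rewrite /= sub0r normrN.
  by rewrite pik h2; split=> //; rewrite /k distrC.
have half_lt (v : torus_space T1) : `|v| < d -> `|2^-1 *: v| < d.
  move=> vd; apply: le_lt_trans vd.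
  by rewrite normrZ ger0_norm ?invr_ge0 ?ler0n // ler_piMl // invf_le1 ?ler1n ?ltr0n.
have kD v : `|v| < d -> k v = 2 *: k (2^-1 *: v).
  move=> vd; have [k1 p1] := dP _ vd; have [k2 p2] := dP _ (half_lt _ vd).
  apply/eqP; rewrite -subr_eq0; apply/eqP/eL.
    rewrite -torus_pi_eq0 scaler_nat raddfB raddfMn /= p1 p2.
    have -> : f (torus_pi v) = f (torus_pi (2^-1 *: v)) *+ 2.
      rewrite -raddfMn -raddfMn -(scaler_nat 2 (_ *: v)) scalerA.
      by rewrite divff ?pnatr_eq0 // scale1r.
    by rewrite subrr.
  apply: le_lt_trans (ler_normB _ _) _.
  rewrite normrZ ger0_norm ?ler0n //.
  have -> : e = e / 3 + 2 * (e / 3).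
    by rewrite -[X in X + _]mul1r -mulrDl mulrC mulfVK // -(natrD _ 1 2) pnatr_eq0.
  by rewrite ltrD // ltr_pM2l // ltr0n.
have rn n v : `|v| < d -> r v = 2 ^+ n *: r (2 ^- n *: v).
  elim: n v => [|n IH] v vd; first by rewrite expr0 invr1 !scale1r.
  have -> : r v = 2 *: r (2^-1 *: v).
    have vE : v = 2 *: (2^-1 *: v).
      by rewrite scalerA divff ?pnatr_eq0 // scale1r.
    by rewrite /r scalerBr -kD // {2}vE linearZ.
  rewrite (IH _ (half_lt _ vd)) !scalerA exprS; congr (_ *: r (_ *: _)).
  by rewrite invfM mulrC.
have r0 v : `|v| < d -> r v = 0.
  move=> vd.
  have bnd (eps : R[i]) : 0 < eps -> `|r v| <= eps * `|v|.
    move=> eps0; have /(_ eps eps0) H := hr.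
    have [d' d'0 dU] := (iffLR (nbhs_normP _ _)) H.
    have [n nv] := small_scale v d'0.
    rewrite (rn n) // normrZ gtr0_norm ?exprn_gt0 ?ltr0n //.
    have := dU (2 ^- n *: v); rewrite /= sub0r normrN => /(_ nv).
    rewrite !fctE /= addr0 opprD addrA => le1.
    rewrite mulrC -ler_pdivlMr ?exprn_gt0 ?ltr0n //.
    apply: (le_trans le1).
    rewrite normrZ gtr0_norm ?invr_gt0 ?exprn_gt0 ?ltr0n //.
    by rewrite mulrA [leRHS]mulrAC.
  have [v0|v0] := eqVneq v 0.
    have := bnd 1 ltr01; rewrite [in leRHS]v0 normr0 mulr0 normr_le0.
    by move/eqP.
  apply/eqP/negPn/negP => rv0.
  have rp : 0 < `|r v| by rewrite normr_gt0.
  have vp : 0 < `|v| by rewrite normr_gt0.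
  have := bnd (`|r v| / 2 / `|v|).
  rewrite !divr_gt0 ?ltr0n // => /(_ isT); rewrite divfK ?gt_eqF //.
  by rewrite ler_pdivlMr ?ltr0n // ger_pMr // (ler_nat _ 2 1).
move=> v; have [n nv] := small_scale v d0.
have [_ pv] := dP _ nv.
have kE : k (2 ^- n *: v) = D (2 ^- n *: v).
  by apply/eqP; rewrite -subr_eq0; apply/eqP; exact: r0.
have vE : v = (2 ^- n *: v) *+ (2 ^ n).
  by rewrite -(scaler_nat _ (_ *: v)) scalerA natrX divff ?scale1r // expf_neq0 // pnatr_eq0.
by rewrite {1}vE 2!raddfMn -pv kE -raddfMn /= -raddfMn -vE.
Qed.

Lemma analytic_rep_unique (R : realType) (T1 T2 : complexTorus R)
    (f : torusHom T1 T2) (F G : {linear torus_space T1 -> torus_space T2}) :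
  (forall v, f (torus_pi v) = torus_pi (F v)) ->
  (forall v, f (torus_pi v) = torus_pi (G v)) -> F =1 G.
Proof.
move=> hF hG v; apply/eqP; rewrite -subr_eq0; apply/eqP.
have [e e0 eL] := lattice_gap T2.
have [n nv] := small_scale (F v - G v) e0.
have : 2 ^- n *: (F v - G v) = 0.
  apply: eL => //; rewrite scalerBr -!linearZ_LR -torus_pi_eq0 raddfB /=.
  by rewrite -hF -hG subrr.
move/eqP; rewrite scaler_eq0 invr_eq0 expf_eq0 pnatr_eq0 andbF /=.
by move/eqP.
Qed.

Section Homomorphism.
Variable R : realType.
Implicit Types T : complexTorus R.

Definition analytic_rep T1 T2 (f : torusHom T1 T2) :
    {linear torus_space T1 -> torus_space T2} :=
  projT1 (cid (analytic_rep_exists f)).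

Lemma analytic_repP T1 T2 (f : torusHom T1 T2) v :
  f (torus_pi v) = torus_pi (analytic_rep f v).
Proof. exact: (projT2 (cid (analytic_rep_exists f))). Qed.

Lemma analytic_rep_lattice T1 T2 (f : torusHom T1 T2) v :
  v \in torus_lattice T1 -> analytic_rep f v \in torus_lattice T2.
Proof.
by rewrite -!torus_pi_eq0 -analytic_repP => /eqP ->; rewrite raddf0.
Qed.

Definition lattice_coord T (B : latticeBasis T) (x : torus_space T) :
    'rV[int]_(2 * torus_dim T) :=
  xget 0 [set c : 'rV[int]_(2 * torus_dim T) | x = \sum_i B i *~ c 0 i].

Lemma lattice_coordP T (B : latticeBasis T) x : x \in torus_lattice T ->
  x = \sum_i B i *~ lattice_coord B x 0 i.
Proof.
move=> xL; have [c [xc _]] := (lattice_basisP B).2 x xL.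
apply: (xgetPex 0 (P := [set c : 'rV[int]_(2 * torus_dim T) |
  x = \sum_i B i *~ c 0 i])).
by exists c.
Qed.

Definition rational_mx T1 T2 (f : torusHom T1 T2)
    (B1 : latticeBasis T1) (B2 : latticeBasis T2) :
    'M[int]_(2 * torus_dim T2, 2 * torus_dim T1) :=
  \matrix_(i, j) lattice_coord B2 (analytic_rep f (B1 j)) 0 i.

Lemma rational_mxP T1 T2 (f : torusHom T1 T2)
    (B1 : latticeBasis T1) (B2 : latticeBasis T2) j :
  analytic_rep f (B1 j) = \sum_i B2 i *~ rational_mx f B1 B2 i j.
Proof.
have L1 := (lattice_basisP B1).1 j.
rewrite {1}(lattice_coordP B2 (analytic_rep_lattice f L1)).
by apply: eq_bigr => i _; rewrite mxE.
Qed.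

Definition hom_ker T1 T2 (f : torusHom T1 T2) : set T1 := [set t | f t = 0].

Definition has_finite_kernel T1 T2 (f : torusHom T1 T2) : Prop :=
  finite_set (hom_ker f).

Definition isogeny T1 T2 (f : torusHom T1 T2) : Prop :=
  (forall s : T2, exists t : T1, f t = s) /\ has_finite_kernel f.

Definition hom_degree T1 T2 (f : torusHom T1 T2) : nat := #|` fset_set (hom_ker f)|.

Definition kills_kernel T1 T2 (f : torusHom T1 T2) (n : nat) : Prop :=
  (0 < n)%N /\ forall t, hom_ker f t -> t *+ n = 0.

Definition hom_exponent T1 T2 (f : torusHom T1 T2) : nat :=
  xget 0%N [set n | kills_kernel f n /\ forall m, kills_kernel f m -> (n <= m)%N].

Lemma hom_exponentP T1 T2 (f : torusHom T1 T2) : has_finite_kernel f ->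
  kills_kernel f (hom_exponent f) /\
  forall m, kills_kernel f m -> (hom_exponent f <= m)%N.
Proof.
move=> fin.
have tors t : hom_ker f t -> exists n, (0 < n)%N /\ t *+ n = 0.
  move=> kt; apply: contrapT => nex.
  have inj : injective (fun n => t *+ n).
    move=> i j; wlog ij : i j / (i <= j)%N.
      by move=> W E; case/orP: (leq_total i j) => H; [|symmetry]; apply: W.
    move=> E; apply/eqP; apply: contrapT => /negP nij; apply: nex.
    exists (j - i)%N; rewrite subn_gt0 ltn_neqAle nij ij; split => //.
    by rewrite mulrnBr // E subrr.
  apply: infinite_nat.
  have -> : [set: nat] = (fun n => t *+ n) @^-1` hom_ker f.
    by apply/seteqP; split=> // n _; rewrite /= /hom_ker /= raddfMn kt mul0rn.
  by apply: finite_preimage fin => i j _ _; exact: inj.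
have exk : exists n, kills_kernel f n.
  have [s sE] := (iffLR (finite_seqP _)) fin.
  have {}tors t : t \in s -> exists n, (0 < n)%N /\ t *+ n = 0.
    by move=> ts; apply: tors; rewrite sE.
  suff [n n0 nP] : exists2 n, (0 < n)%N & forall t, t \in s -> t *+ n = 0.
    by exists n; split=> // t; rewrite sE; exact: nP.
  elim: s tors {sE} => [|x s IH] tors; first by exists 1%N.
  have [t ts|n n0 nP] := IH; first by apply: tors; rewrite inE ts orbT.
  have [m [m0 mx]] := tors x (mem_head _ _).
  exists (m * n)%N; first by rewrite muln_gt0 m0.
  move=> t; rewrite inE => /orP[/eqP->|ts]; first by rewrite mulrnA mx mul0rn.
  by rewrite mulnC mulrnA nP // mul0rn.
have exb : exists n, `[< kills_kernel f n >].
  by case: exk => n nP; exists n; apply/asboolP.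
apply: (xgetPex 0%N (P := [set n | kills_kernel f n /\
  forall m, kills_kernel f m -> (n <= m)%N])).
case: (ex_minnP exb) => n /asboolP nP nmin; exists n; split => // m mP.
by apply: nmin; apply/asboolP.
Qed.

Definition inverse_isogeny T1 T2 (f : torusHom T1 T2) (f' : torusHom T2 T1) :
    Prop :=
  [/\ isogeny f',
      forall t : T2, f (f' t) = t *+ hom_exponent f &
      forall t : T1, f' (f t) = t *+ hom_exponent f].

End Homomorphism.

Definition increasing_ffun k m (s : {ffun 'I_k -> 'I_m}) : bool :=
  [forall i : 'I_k, forall j : 'I_k, (i < j)%N ==> (s i < s j)%N].

(* The iterated gcdn starts at 0 and gcdn 0 0 = 0, so this is 0 when all the
   minors of order k vanish or when there are none; for k = 0 the only minor is
   the empty determinant 1. *)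
Definition det_divisor m n (A : 'M[int]_(m, n)) (k : nat) : nat :=
  \big[gcdn/0%N]_(s : {ffun 'I_k -> 'I_m} | increasing_ffun s)
    \big[gcdn/0%N]_(t : {ffun 'I_k -> 'I_n} | increasing_ffun t)
      `|\det (mxsub s t A)|%N.

Section HomType.
Variable R : realType.
Implicit Types T : complexTorus R.

Definition hom_delta T1 T2 (f : torusHom T1 T2)
    (B1 : latticeBasis T1) (B2 : latticeBasis T2) (k : nat) : nat :=
  det_divisor (rational_mx f B1 B2) k.

(* Meaningful for 1 <= k <= rank, where the division is exact: expanding a
   minor of order k along a row shows that delta_(k-1) divides delta_k. *)
Definition hom_d T1 T2 (f : torusHom T1 T2)
    (B1 : latticeBasis T1) (B2 : latticeBasis T2) (k : nat) : nat :=
  hom_delta f B1 B2 k %/ hom_delta f B1 B2 k.-1.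

Definition hom_rank T1 T2 (f : torusHom T1 T2)
    (B1 : latticeBasis T1) (B2 : latticeBasis T2) : nat :=
  \rank (map_mx intr (rational_mx f B1 B2) : 'M[rat]_(_, _)).

Definition hom_type T1 T2 (f : torusHom T1 T2)
    (B1 : latticeBasis T1) (B2 : latticeBasis T2) : seq nat :=
  [seq hom_d f B1 B2 k | k <- iota 1 (hom_rank f B1 B2)].

End HomType.

(* Main.v *)
Require Import Defs.
From mathcomp Require Import all_boot all_order all_algebra perm.
From mathcomp Require Import generic_quotient finmap classical_sets cardinality.
From mathcomp Require Import reals complex.

(** Everything is read off from one pair of lattice bases adapted to [f].

    By the Smith normal form of the integral matrix of [f], there are bases
    [b1] of [L1] and [b2] of [L2] and integers [d 0], [d 1], ..., each dividing
    the next, such that the analytic representation [F] sends [b1 j] to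
    [d j] times [b2 j] (lemma [adapted_bases_exist]). A finite kernel forces
    [F] to be injective: the points [v / 2 ^ n] of a line killed by [F] would
    all become lattice points after multiplication by the exponent, which
    discreteness forbids (lemma [analytic_rep_inj]). Hence the [d j] with
    [j < 2 g1] are non-zero and [2 g1 <= 2 g2].

    The determinantal divisors do not depend on the bases, because the minors
    of a product [P A Q] are integral combinations of the minors of [A]
    (lemma [dvdn_det_divisor_mulmx]); on the diagonal matrix, the [k]-th one is
    the product of the [k] first entries (lemma [det_divisor_diag]). So the type
    of [f] consists of the absolute values of the [d j].

    The kernel of [f] consists of the classes of the vectors
    [\sum_j (c j / d j) b1 j] with integers [c j], and such a class is zero
    exactly when each [d j] divides [c j] (lemmas [diag_torsion_surj] and
    [diag_torsion_in_lattice]). The kernel is therefore the product of the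
    groups Z / d_j Z: its order is the product of the [d j], and its exponent
    is the last of them, up to sign.

    Finally, when [f'] is the inverse isogeny, [F' \o F] is multiplication by
    the exponent [e], so [F'] sends [b2 j] to [e / d j] times [b1 j]. Reading
    both bases backwards turns these quotients into a divisibility chain, so
    that the results above apply to [f'] (lemma [inverse_isogeny_diag]). *)

Set Implicit Arguments. Unset Strict Implicit. Unset Printing Implicit Defensive.
Import Order.TTheory GRing.Theory Num.Theory.
Local Open Scope ring_scope.

(** * Minors and determinantal divisors *)

(** The Cauchy-Binet expansion before its terms are grouped: the sum runs over
    all maps [h], not only the increasing ones. This form suffices to see the
    determinant as a combination of minors of [Y]. *)
Lemma det_mulmx_expand (K : comNzRingType) k m
    (X : 'M[K]_(k, m)) (Y : 'M[K]_(m, k)) :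
  \det (X *m Y) =
    \sum_(h : {ffun 'I_k -> 'I_m}) (\prod_i X i (h i)) * \det (mxsub h id Y).
Proof.
pose XY (p : 'S_k) i l := X i l * Y l (p i).
transitivity (\sum_(h : {ffun 'I_k -> 'I_m})
    \sum_(p : 'S_k) (-1) ^+ p * \prod_i XY p i (h i)).
  rewrite exchange_big; apply: eq_bigr => /= p _; rewrite -big_distrr /=.
  congr (_ * _); rewrite -(bigA_distr_bigA (XY p)) /=.
  by apply: eq_bigr => i _; rewrite mxE.
apply: eq_bigr => h _; rewrite big_distrr /=; apply: eq_bigr => p _.
rewrite mulrCA big_split //=; congr (_ * (_ * _)).
by apply: eq_bigr => i _; rewrite mxE.
Qed.

Lemma increasing_perm k m (s : 'I_k -> 'I_m) : injective s ->
  exists p : 'S_k, increasing_ffun [ffun i => s (p i)].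
Proof.
move=> s_inj; pose le (x y : 'I_m) := (x <= y)%N.
have /tuple_permP[p pE] : perm_eq (sort le [tuple s i | i < k]) [tuple s i | i < k].
  by rewrite perm_sort.
exists p; apply/forallP => i; apply/forallP => j; apply/implyP => ij.
have nthE (l : 'I_k) : nth (s i) (sort le [tuple s i | i < k]) l = s (p l).
  by rewrite pE -tnth_nth !tnth_mktuple.
rewrite !ffunE ltn_neqAle; apply/andP; split.
  apply: contraTneq ij => /val_inj/s_inj/perm_inj ->.
  by rewrite ltnn.
rewrite -!nthE; apply: (@sorted_leq_nth _ le).
- by move=> x y z; exact: leq_trans.
- by move=> x; exact: leqnn.
- by apply: sort_sorted => x y; exact: leq_total.
- by rewrite inE size_sort size_tuple.
- by rewrite inE size_sort size_tuple.
- exact: ltnW.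
Qed.

(** Sorting the selected rows only changes the sign of a minor, and repeating a
    row makes it vanish, so increasing selections control all the others. *)
Lemma dvd_all_row_minors (k m : nat) (A : 'M[int]_(m, k)) g :
  (forall s : {ffun 'I_k -> 'I_m}, increasing_ffun s ->
     (g %| \det (mxsub s id A))%Z) ->
  forall s : 'I_k -> 'I_m, (g %| \det (mxsub s id A))%Z.
Proof.
move=> gA s; case: (injectiveP s) => [|/injectiveP].
  move=> s_inj; have [p ps] := increasing_perm s_inj.
  have := gA _ ps; rewrite mxsub_ffunl.
  have -> : mxsub (fun i => s (p i)) id A = row_perm p (mxsub s id A).
    by apply/matrixP => i j; rewrite !mxE.
  rewrite row_permE det_mulmx det_perm dvdzE abszMsign.
  by rewrite -dvdzE.
move=> /injectivePn[i1 [i2 ne12 e12]].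
by rewrite (determinant_alternate ne12) ?dvdz0 // => j; rewrite !mxE e12.
Qed.

Lemma dvd_all_minors m n (A : 'M[int]_(m, n)) k g :
  (forall (s : {ffun 'I_k -> 'I_m}) (t : {ffun 'I_k -> 'I_n}),
     increasing_ffun s -> increasing_ffun t ->
     (g %| \det (mxsub s t A))%Z) ->
  forall (s : 'I_k -> 'I_m) (t : 'I_k -> 'I_n), (g %| \det (mxsub s t A))%Z.
Proof.
move=> gA s t; rewrite mxsubrc; apply: dvd_all_row_minors => s' s'_inc.
rewrite -mxsubrc mxsubcr -det_tr trmx_mxsub.
apply: dvd_all_row_minors => t' t'_inc.
by rewrite -trmx_mxsub det_tr -mxsubcr; exact: gA.
Qed.

(** Allowing arbitrary row and column selections frees later arguments from
    keeping selections increasing. *)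
Lemma det_divisorP m n (A : 'M[int]_(m, n)) k g :
  (g %| det_divisor A k)%N <->
  forall (s : 'I_k -> 'I_m) (t : 'I_k -> 'I_n), (g%:Z %| \det (mxsub s t A))%Z.
Proof.
split=> [/dvdn_biggcdP gA|gA].
  apply: dvd_all_minors => s t s_inc t_inc.
  by have /dvdn_biggcdP/(_ t t_inc) := gA s s_inc; rewrite dvdzE.
apply/dvdn_biggcdP => s _; apply/dvdn_biggcdP => t _.
exact: gA.
Qed.

Lemma det_divisor_dvd m n (A : 'M[int]_(m, n)) k s t :
  ((det_divisor A k)%:Z %| \det (mxsub s t A : 'M_k))%Z.
Proof. by move: s t; apply/det_divisorP. Qed.

(** Expanding along the rows of [A], then along its columns, writes each minor
    of the product as a combination of minors of [A]. *)
Lemma dvdn_det_divisor_mulmx m n m' n' (P : 'M[int]_(m', m))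
    (A : 'M[int]_(m, n)) (Q : 'M[int]_(n, n')) k :
  (det_divisor A k %| det_divisor (P *m A *m Q) k)%N.
Proof.
apply/det_divisorP => s t.
rewrite -mulmxA mxsub_mul det_mulmx_expand; apply: rpred_sum => h _.
apply: dvdz_mull; rewrite -mxsub_comp -det_tr trmx_mxsub trmx_mul.
rewrite mxsub_mul det_mulmx_expand; apply: rpred_sum => l _.
apply: dvdz_mull; rewrite -mxsub_comp -trmx_mxsub det_tr.
exact: det_divisor_dvd.
Qed.

Lemma leq_increasing_ffun k m (s : {ffun 'I_k -> 'I_m}) (i : 'I_k) :
  increasing_ffun s -> (i <= s i)%N.
Proof.
move=> s_inc; case: i => i; elim: i => [//|i IH] ik.
apply: leq_ltn_trans (IH (ltnW ik)) _.
by have /forallP/(_ (Ordinal (ltnW ik)))/forallP/(_ (Ordinal ik))/implyP := s_inc; apply.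
Qed.

Definition rect_diag (d : nat -> int) m n : 'M[int]_(m, n) :=
  \matrix_(i, j) (d i *+ (i == j :> nat)).

(** The leading minor is the product of the first [k] entries. It divides every
    other minor: a non-zero term of a minor with increasing rows [s] is the
    product of the [d (s i)], and [i <= s i]. *)
Lemma det_divisor_diag m n (d : nat -> int) k :
  (forall i j, (i <= j < m)%N -> (d i %| d j)%Z) -> (k <= m)%N -> (k <= n)%N ->
  det_divisor (rect_diag d m n) k = (\prod_(i < k) `|d i|)%N.
Proof.
move=> d_chain km kn.
have prodE : `|(\prod_(i < k) d i)%R|%N = (\prod_(i < k) `|d i|)%N.
  by apply: (big_ind2 (fun (x : int) y => `|x|%N = y)) => // x _ y _ <- <-; rewrite abszM.
apply/eqP; rewrite eqn_dvd; apply/andP; split.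
  have := det_divisor_dvd (rect_diag d m n) (widen_ord km) (widen_ord kn).
  suff -> : mxsub (widen_ord km) (widen_ord kn) (rect_diag d m n) =
      diag_mx (\row_(i < k) d i).
    rewrite det_diag dvdzE -prodE.
    by congr (_ %| `|_|)%N; apply: eq_bigr => i _; rewrite mxE.
  by apply/matrixP => i j; rewrite !mxE.
apply/dvdn_biggcdP => s s_inc; apply/dvdn_biggcdP => t _.
rewrite -prodE -dvdzE; apply: rpred_sum => p _; apply: dvdz_mull.
apply: (big_ind2 (fun x y => (x %| y)%Z)) => // [x1 x2 y1 y2|i _].
  exact: dvdz_mul.
rewrite !mxE; case: eqP => _; rewrite ?dvdz0 //.
by apply: d_chain; rewrite leq_increasing_ffun /=.
Qed.

(** * Lattice bases and matrices of homomorphisms *)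

Section Bases.
Variable R : realType.
Implicit Types T : complexTorus R.

Lemma zbasis_inj (V : zmodType) (L : zmodClosed V) n (b : 'I_n -> V)
    (c c' : 'I_n -> int) :
  is_zbasis L b -> \sum_i b i *~ c i = \sum_i b i *~ c' i -> c =1 c'.
Proof.
move=> [bL buniq] ecc'.
have xL : \sum_i b i *~ c i \in L by apply: rpred_sum => i _; exact: rpredMz.
have [z [_ zu]] := buniq _ xL.
have zc : z = \row_i c i.
  by apply: zu; apply: eq_bigr => i _; rewrite mxE.
have zc' : z = \row_i c' i.
  by apply: zu; rewrite ecc'; apply: eq_bigr => i _; rewrite mxE.
by move=> i; move: zc'; rewrite zc => /rowP/(_ i); rewrite !mxE.
Qed.

Lemma sum_mulrz_mulmx (V : zmodType) m n p (b : 'I_m -> V)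
    (P : 'M[int]_(m, n)) (Q : 'M[int]_(n, p)) l :
  \sum_j (\sum_i b i *~ P i j) *~ Q j l = \sum_i b i *~ (P *m Q) i l.
Proof.
under eq_bigr => j _ do rewrite mulrz_suml.
rewrite exchange_big; apply: eq_bigr => i _.
rewrite mxE mulrz_sumr; apply: eq_bigr => j _.
by rewrite mulrzA.
Qed.

Lemma is_zbasis_unitmx (V : zmodType) (L : zmodClosed V) n (b : 'I_n -> V)
    (U : 'M[int]_n) :
  is_zbasis L b -> U \in unitmx -> is_zbasis L (fun j => \sum_i b i *~ U i j).
Proof.
move=> bB uU; have [bL buniq] := bB; split=> [j|x xL].
  by apply: rpred_sum => i _; exact: rpredMz.
have colE (c : 'rV[int]_n) : \sum_j (\sum_i b i *~ U i j) *~ c 0 j =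
    \sum_i b i *~ (U *m c^T) i 0.
  by rewrite -sum_mulrz_mulmx; apply: eq_bigr => j _; rewrite mxE.
have [c [xc cu]] := buniq x xL; exists (invmx U *m c^T)^T; split.
  by rewrite colE trmxK mulKVmx // xc; apply: eq_bigr => i _; rewrite mxE.
move=> c'; rewrite colE xc => /(zbasis_inj bB) cE.
apply: trmx_inj; rewrite trmxK.
suff -> : c^T = U *m c'^T by rewrite mulKmx.
by apply/colP => i; rewrite -cE mxE.
Qed.

Definition change_basis T (B : latticeBasis T) U (uU : U \in unitmx) :=
  LatticeBasis (is_zbasis_unitmx (lattice_basisP B) uU).

Lemma reversed_basis T (B : latticeBasis T) :
  exists B' : latticeBasis T, forall j, B' j = B (rev_ord j).
Proof.
have uU := unitmx_perm int (perm (@rev_ord_inj (2 * torus_dim T))).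
exists (change_basis B uU) => j /=.
rewrite (bigD1 (rev_ord j)) //= big1 => [|i ij].
  by rewrite !mxE permE rev_ordK eqxx addr0.
rewrite !mxE permE; case: eqP => // jE.
by rewrite -jE rev_ordK eqxx in ij.
Qed.

Lemma rational_mx_unique T1 T2 (f : torusHom T1 T2) (B1 : latticeBasis T1)
    (B2 : latticeBasis T2) (M : 'M[int]__) :
  (forall j, analytic_rep f (B1 j) = \sum_i B2 i *~ M i j) ->
  rational_mx f B1 B2 = M.
Proof.
move=> FM; apply/matrixP => i j.
exact: (zbasis_inj (lattice_basisP B2)
  (etrans (esym (rational_mxP f B1 B2 j)) (FM j))).
Qed.

Lemma lattice_transition_mx T (B B' : latticeBasis T) :
  exists P : 'M[int]__, forall j, B' j = \sum_i B i *~ P i j.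
Proof.
exists (\matrix_(i, j) lattice_coord B (B' j) 0 i) => j.
rewrite {1}(lattice_coordP B ((lattice_basisP B').1 j)).
by apply: eq_bigr => i _; rewrite mxE.
Qed.

Lemma analytic_rep_sum T1 T2 (f : torusHom T1 T2) (B1 : latticeBasis T1)
    (B2 : latticeBasis T2) n (P : 'M[int]_(_, n)) l :
  analytic_rep f (\sum_j B1 j *~ P j l) =
  \sum_i B2 i *~ (rational_mx f B1 B2 *m P) i l.
Proof.
rewrite linear_sum -sum_mulrz_mulmx; apply: eq_bigr => j _.
by rewrite -rational_mxP raddfMz.
Qed.

(** A change of bases in either direction multiplies the matrix by integral
    matrices, so each of the two divisors divides the other. *)
Lemma hom_delta_basis T1 T2 (f : torusHom T1 T2) (B1 b1 : latticeBasis T1)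
    (B2 b2 : latticeBasis T2) k :
  hom_delta f B1 B2 k = hom_delta f b1 b2 k.
Proof.
apply/eqP; rewrite eqn_dvd.
wlog suff dvd : B1 b1 B2 b2 / (hom_delta f B1 B2 k %| hom_delta f b1 b2 k)%N.
  by apply/andP.
have [P1 P1E] := lattice_transition_mx B1 b1.
have [P2 P2E] := lattice_transition_mx b2 B2.
rewrite /hom_delta (_ : rational_mx f b1 b2 =
  P2 *m rational_mx f B1 B2 *m P1); first exact: dvdn_det_divisor_mulmx.
apply: rational_mx_unique => j; rewrite P1E (analytic_rep_sum f B1 B2).
rewrite -mulmxA -(sum_mulrz_mulmx b2).
by apply: eq_bigr => i _; rewrite P2E.
Qed.

(** If [A = P D Q] is the Smith decomposition of the matrix of [f], the columns
    of the inverse of [Q] and of [P] give the coordinates of the new bases. *)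
Lemma adapted_bases_exist T1 T2 (f : torusHom T1 T2) (B1 : latticeBasis T1)
    (B2 : latticeBasis T2) :
  exists (b1 : latticeBasis T1) (b2 : latticeBasis T2) (d : nat -> int),
    rational_mx f b1 b2 = rect_diag d _ _ /\
    forall i j, (i <= j)%N -> (d i %| d j)%Z.
Proof.
have [P uP [Q uQ [d d_sorted AE]]] := int_Smith_normal_form (rational_mx f B1 B2).
have uQ' : invmx Q \in unitmx by rewrite unitmx_inv.
exists (change_basis B1 uQ'), (change_basis B2 uP), (fun i => d`_i); split.
  apply: rational_mx_unique => j /=.
  rewrite (analytic_rep_sum f B1 B2) sum_mulrz_mulmx AE mulmxK //.
move=> i j ij; have [jd|dj] := ltnP j (size d); last by rewrite [d`_j]nth_default ?dvdz0.
have dvdz_tr : transitive dvdz by move=> x y z; exact: dvdz_trans.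
have dvdz_rf : reflexive dvdz by exact: dvdzz.
by apply: (sorted_leq_nth dvdz_tr dvdz_rf) => //; exact: leq_ltn_trans jd.
Qed.

(** The vectors [v / 2 ^ n] tend to zero, while non-zero lattice vectors are
    bounded away from it. *)
Lemma halves_in_lattice T (v : torus_space T) :
  (forall n, 2 ^- n *: v \in torus_lattice T) -> v = 0.
Proof.
move=> vL; have [e e0 eL] := lattice_gap T.
have [n nv] := small_scale v e0.
have /eqP := eL _ (vL n) nv.
by rewrite scaler_eq0 invr_eq0 expf_eq0 pnatr_eq0 andbF /= => /eqP.
Qed.

(** If [F v = 0], all the [v / 2 ^ n] represent points of the kernel, hence are
    in the lattice once multiplied by the exponent of the kernel. *)
Lemma analytic_rep_inj T1 T2 (f : torusHom T1 T2) : has_finite_kernel f ->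
  forall v, analytic_rep f v = 0 -> v = 0.
Proof.
move=> fin v Fv; have [[e0 eK] _] := hom_exponentP fin.
suff : v *+ hom_exponent f = 0.
  by move/eqP; rewrite -scaler_nat scaler_eq0 pnatr_eq0 (gtn_eqF e0) => /eqP.
apply: halves_in_lattice => n; rewrite -torus_pi_eq0 -scalerMnr raddfMn /=.
apply/eqP/eK; rewrite /hom_ker /= analytic_repP linearZ /= Fv scaler0.
exact: raddf0.
Qed.
End Bases.

(** * The kernel in adapted bases *)

(** Coordinates on the first [n] vectors of a family, extended by zero beyond
    them. *)
Lemma sum_widen_ord (V : zmodType) n m (b : 'I_m -> V) (nm : (n <= m)%N)
    (c : 'I_n -> int) :
  \sum_j b (widen_ord nm j) *~ c j = \sum_i b i *~ oapp c 0 (insub (val i)).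
Proof.
rewrite [RHS](bigID (fun i : 'I_m => i < n)%N) /= [X in _ + X]big1 ?addr0.
  by rewrite big_ord_narrow; apply: eq_bigr => j _; rewrite valK.
by move=> i /negPf ni; rewrite insubF.
Qed.

Lemma zbasis_widen_inj (V : zmodType) (L : zmodClosed V) n m (b : 'I_m -> V)
    (c c' : 'I_n -> int) : is_zbasis L b -> forall nm : (n <= m)%N,
  \sum_j b (widen_ord nm j) *~ c j = \sum_j b (widen_ord nm j) *~ c' j -> c =1 c'.
Proof.
move=> bB nm; rewrite !sum_widen_ord => /(zbasis_inj bB) cc' j.
by have := cc' (widen_ord nm j); rewrite /= valK.
Qed.

Section Adapted.
Variables (R : realType) (T1 T2 : complexTorus R) (f : torusHom T1 T2).
Variables (b1 : latticeBasis T1) (b2 : latticeBasis T2) (d : nat -> int).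
Let n1 := (2 * torus_dim T1)%N.
Let n2 := (2 * torus_dim T2)%N.
Hypothesis f_fin : has_finite_kernel f.
Hypothesis f_diag : rational_mx f b1 b2 = rect_diag d _ _.
Hypothesis d_chain : forall i j, (i <= j < n2)%N -> (d i %| d j)%Z.

Lemma latticeBasis_neq0 (T : complexTorus R) (b : latticeBasis T) j : b j != 0.
Proof.
apply/eqP => bj0.
have E : (fun i => (i == j)%:Z) =1 (fun=> 0).
  apply: (zbasis_inj (lattice_basisP b)); rewrite !big1 // => i _.
  by case: eqP => [->|//]; rewrite bj0 mul0rz.
by have := E j; rewrite eqxx.
Qed.

Lemma diag_basis_image (j : 'I_n1) :
  analytic_rep f (b1 j) = \sum_i b2 i *~ (d i *+ (i == j :> nat)).
Proof. by rewrite (rational_mxP f b1 b2) f_diag; apply: eq_bigr => i _; rewrite mxE. Qed.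

Lemma diag_image_neq0 (j : 'I_n1) : analytic_rep f (b1 j) != 0.
Proof.
by apply: contra_neq (latticeBasis_neq0 b1 j) => /(analytic_rep_inj f_fin).
Qed.

(** A column of the diagonal matrix beyond its last row would be zero, that is,
    a basis vector killed by the injective map [F]. *)
Lemma diag_dim_leq : (n1 <= n2)%N.
Proof.
rewrite leqNgt; apply/negP => lt21.
have /eqP[] := diag_image_neq0 (Ordinal lt21).
rewrite diag_basis_image big1 // => i _.
by rewrite ltn_eqF //= mulr0z.
Qed.

Lemma diag_basis_imageE (j : 'I_n1) :
  analytic_rep f (b1 j) = b2 (widen_ord diag_dim_leq j) *~ d j.
Proof.
rewrite diag_basis_image (bigD1 (widen_ord diag_dim_leq j)) //= eqxx mulr1n.
rewrite big1 ?addr0 // => i /negPf ij.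
by rewrite -[(_ == _ :> nat)]/(i == widen_ord diag_dim_leq j) ij mulr0z.
Qed.

Lemma diag_neq0 j : (j < n1)%N -> d j != 0.
Proof.
move=> jn; have := diag_image_neq0 (Ordinal jn); rewrite diag_basis_imageE /=.
by apply: contra_neq => ->; rewrite mulr0z.
Qed.

Lemma diag_hom_delta (B1 : latticeBasis T1) (B2 : latticeBasis T2) k :
  (k <= n1)%N -> hom_delta f B1 B2 k = (\prod_(i < k) `|d i|)%N.
Proof.
move=> kn; rewrite (hom_delta_basis f B1 b1 B2 b2) /hom_delta f_diag.
by rewrite det_divisor_diag // (leq_trans kn) // diag_dim_leq.
Qed.

Lemma diag_hom_d (B1 : latticeBasis T1) (B2 : latticeBasis T2) k :
  (k < n1)%N -> hom_d f B1 B2 k.+1 = `|d k|%N.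
Proof.
move=> kn; rewrite /hom_d /= !diag_hom_delta ?(ltnW kn) // big_ord_recr /=.
rewrite mulKn // prodn_gt0 // => i.
by rewrite absz_gt0 diag_neq0 // (ltn_trans _ kn).
Qed.

(** The preimage under [F] of the vector with coordinates [c] on the first
    vectors of [b2]; these preimages represent the points of the kernel. *)
Definition diag_torsion (c : 'I_n1 -> int) : torus_space T1 :=
  \sum_j ((c j)%:~R / (d j)%:~R) *: b1 j.

Lemma diag_torsionE c : analytic_rep f (diag_torsion c) =
  \sum_j b2 (widen_ord diag_dim_leq j) *~ c j.
Proof.
rewrite linear_sum; apply: eq_bigr => j _.
rewrite linearZ /= diag_basis_imageE -[b2 _ *~ _]scaler_int scalerA divfK ?scaler_int //.
by rewrite intr_eq0 diag_neq0.
Qed.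

Lemma diag_torsion_ker c : hom_ker f (torus_pi (diag_torsion c)).
Proof.
rewrite /hom_ker /= analytic_repP diag_torsionE; apply/eqP; rewrite torus_pi_eq0.
by apply: rpred_sum => j _; apply: rpredMz; exact: (lattice_basisP b2).1.
Qed.

Lemma diag_torsion_in_lattice c :
  reflect (forall j : 'I_n1, (d j %| c j)%Z) (diag_torsion c \in torus_lattice T1).
Proof.
apply: (iffP idP) => [cL j|dc].
  have [z [cz _]] := (lattice_basisP b1).2 _ cL.
  suff /(_ j) -> : c =1 (fun i => d i * z 0 i) by exact: dvdz_mulr.
  apply: (zbasis_widen_inj (lattice_basisP b2) (nm := diag_dim_leq)).
  rewrite -diag_torsionE cz linear_sum; apply: eq_bigr => i _.
  by rewrite raddfMz /= diag_basis_imageE mulrzA.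
apply: rpred_sum => j _; have /dvdzP[q ->] := dc j.
rewrite rmorphM /= mulfK ?intr_eq0 ?diag_neq0 // scaler_int.
by apply: rpredMz; exact: (lattice_basisP b1).1.
Qed.

(** Let [v] represent a point of the kernel and [e] be the exponent. Both [F v]
    and [e v] are lattice vectors, with coordinates [m] and [z]. Comparing the
    two expressions of [F (e v)] gives [z j * d j = m j * e], so that the
    coordinates [z j / e] of [v] are the [m j / d j]. *)
Lemma diag_torsion_surj t : hom_ker f t -> exists c, t = torus_pi (diag_torsion c).
Proof.
have [[e0 eK] _] := hom_exponentP f_fin; set e := hom_exponent f in e0 eK.
have [v ->] : exists v, t = torus_pi v.
  by exists (generic_quotient.repr t); rewrite /torus_pi generic_quotient.reprK.
move=> vK; have /eqP := vK; rewrite /hom_ker /= analytic_repP torus_pi_eq0 => FvL.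
have := eK _ vK; rewrite -raddfMn /= => /eqP; rewrite torus_pi_eq0 => evL.
have [z [evE _]] := (lattice_basisP b1).2 _ evL.
have [m [FvE _]] := (lattice_basisP b2).2 _ FvL.
have zm (j : 'I_n1) : z 0 j * d j = m 0 (widen_ord diag_dim_leq j) * e%:Z.
  have : analytic_rep f (v *+ e) = analytic_rep f v *~ e by rewrite raddfMn.
  rewrite evE FvE linear_sum mulrz_suml.
  under eq_bigr => i _ do rewrite raddfMz /= diag_basis_imageE -mulrzA mulrC.
  under [RHS]eq_bigr => i _ do rewrite -mulrzA.
  rewrite (sum_widen_ord b2 diag_dim_leq (fun i => z 0 i * d i)).
  move=> /(zbasis_inj (lattice_basisP b2))/(_ (widen_ord diag_dim_leq j)).
  by rewrite /= valK.
exists (fun j => m 0 (widen_ord diag_dim_leq j)); congr torus_pi.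
have e_neq0 : e%:R != 0 :> R[i]%C by rewrite pnatr_eq0 -lt0n.
apply: (scalerI e_neq0); rewrite scaler_nat evE scaler_sumr.
apply: eq_bigr => j _; rewrite scalerA -[b1 _ *~ _]scaler_int; congr (_ *: _).
apply: (@mulIf _ (d j)%:~R); first by rewrite intr_eq0 diag_neq0.
by rewrite -mulrA divfK ?intr_eq0 ?diag_neq0 // -intrM zm intrM mulrC.
Qed.

Lemma diag_torsionMn c m :
  diag_torsion c *+ m = diag_torsion (fun j => c j * m%:Z).
Proof.
rewrite -sumrMnl; apply: eq_bigr => j _.
by rewrite scalerMnl intrM mulrAC mulr_natr.
Qed.

Lemma diag_torsionB c c' :
  diag_torsion c - diag_torsion c' = diag_torsion (fun j => c j - c' j).
Proof.
rewrite -sumrB; apply: eq_bigr => j _.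
by rewrite -scalerBl intrB mulrBl.
Qed.

(** The class of [b1 j / d j] for the last [j] has order [|d j|], and the
    coordinates of any other point of the kernel have denominators [d i]
    dividing this [d j]. *)
Lemma diag_kills_kernel m : (0 < n1)%N ->
  kills_kernel f m <-> (0 < m)%N /\ (d n1.-1 %| m%:Z)%Z.
Proof.
move=> n0; have n1n : (n1.-1 < n1)%N by rewrite prednK.
split=> -[m0 mK]; split=> //.
  pose c (j : 'I_n1) : int := (j == Ordinal n1n)%:Z.
  have := mK _ (diag_torsion_ker c); rewrite -raddfMn /= diag_torsionMn.
  move/eqP; rewrite torus_pi_eq0 => /diag_torsion_in_lattice/(_ (Ordinal n1n)).
  by rewrite /c eqxx mul1r.
move=> t /diag_torsion_surj[c ->]; rewrite -raddfMn /= diag_torsionMn.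
apply/eqP; rewrite torus_pi_eq0; apply/diag_torsion_in_lattice => j.
apply/dvdz_mull/(dvdz_trans _ mK)/d_chain.
by rewrite -ltnS prednK // ltn_ord diag_dim_leq.
Qed.

Lemma diag_hom_exponent : (0 < n1)%N -> hom_exponent f = `|d n1.-1|%N.
Proof.
move=> n0; have [eK emin] := hom_exponentP f_fin.
have d0 : (0 < `|d n1.-1|)%N by rewrite absz_gt0 diag_neq0 // prednK.
have [e0 de] := iffLR (diag_kills_kernel _ n0) eK.
apply/eqP; rewrite eqn_leq; apply/andP; split; last exact: dvdn_leq.
by apply: emin; apply/diag_kills_kernel => //; split=> //; rewrite dvdzE.
Qed.

(** Each point of the kernel has a unique representative whose coordinates
    satisfy [0 <= c j < |d j|]. *)
Lemma diag_hom_degree : hom_degree f = (\prod_(i < n1) `|d i|)%N.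
Proof.
have d0 (j : 'I_n1) : d j != 0 by exact: diag_neq0.
pose C := fprod (fun j : 'I_n1 => 'I_`|d j|).
pose g (x : C) := torus_pi (diag_torsion (fun j => (x j : nat)%:Z)).
have g_inj : injective g.
  move=> x y /eqP; rewrite -subr_eq0 -raddfB /= diag_torsionB torus_pi_eq0.
  move=> /diag_torsion_in_lattice xy; apply/fprodP => j; apply/val_inj.
  have := xy j; rewrite -eqz_mod_dvd -(modz_abs (x j : nat)) -(modz_abs (y j : nat)).
  by rewrite !modz_nat !modn_small // eqz_nat => /eqP.
have -> : hom_degree f = #|` [fset g x | x : C]%fset|.
  rewrite /hom_degree; congr #|` _|; apply/fsetP => t.
  rewrite in_fset_set //; apply/idP/imfsetP => [/set_mem tK|[x _ ->]].
    have [c tE] := diag_torsion_surj tK.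
    (* The remainder is non-negative whatever the sign of [d j]. *)
    have cj j : (`|(c j %% d j)%Z| < `|d j|)%N.
      by rewrite -ltz_nat gez0_abs ?modz_ge0 // ltz_mod.
    exists (fprod_of_fun (fun j => Ordinal (cj j))) => //.
    rewrite tE; apply/eqP; rewrite -subr_eq0 -raddfB /= diag_torsionB torus_pi_eq0.
    apply/diag_torsion_in_lattice => j; rewrite fprodE /= gez0_abs ?modz_ge0 //.
    by rewrite {1}(divz_eq (c j) (d j)) addrK dvdz_mull.
  by apply/mem_set; exact: diag_torsion_ker.
rewrite card_imfset //= -cardE card_fprod.
by apply: eq_bigr => j _; rewrite card_ord.
Qed.
End Adapted.

(** * The inverse isogeny *)

(** The two sides agree modulo the lattice for every [v], in particular for all
    the [v / 2 ^ n], so linearity makes their difference vanish. *)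
Lemma analytic_rep_mulrn_comp (R : realType) (T1 T2 : complexTorus R)
    (f : torusHom T1 T2) (f' : torusHom T2 T1) e :
  (forall t, f' (f t) = t *+ e) ->
  forall v, analytic_rep f' (analytic_rep f v) = v *+ e.
Proof.
move=> ffe v; apply/eqP; rewrite -subr_eq0; apply/eqP/halves_in_lattice => n.
rewrite scalerBr -torus_pi_eq0 raddfB /= -!linearZ /= -!analytic_repP ffe.
by rewrite -raddfMn /= scalerMnr subrr.
Qed.

(** The quotients of the last elementary divisor by the others, taken from the
    last one to the first so that they form a divisibility chain again. The
    absolute value makes the numerator the exponent of the kernel. *)
Definition inverse_diag n (d : nat -> int) i : int :=
  (`|d n.-1|%N%:Z %/ d (n - i.+1)%N)%Z.

Section InverseIsogeny.
Variables (R : realType) (T1 T2 : complexTorus R).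
Variables (f : torusHom T1 T2) (f' : torusHom T2 T1).
Variables (b1 : latticeBasis T1) (b2 : latticeBasis T2) (d : nat -> int).
Let n1 := (2 * torus_dim T1)%N.
Let n2 := (2 * torus_dim T2)%N.
Let e := `|d n1.-1|%N.
Hypothesis f_fin : has_finite_kernel f.
Hypothesis f_diag : rational_mx f b1 b2 = rect_diag d _ _.
Hypothesis d_chain : forall i j, (i <= j < n2)%N -> (d i %| d j)%Z.
Hypothesis n1_gt0 : (0 < n1)%N.
Hypothesis ff' : inverse_isogeny f f'.

Lemma inverse_isogeny_finite : has_finite_kernel f'.
Proof. by case: ff' => -[]. Qed.

(** Both [f] and [f'] have a finite kernel, so neither torus has the larger
    dimension. *)
Lemma inverse_isogeny_dim : n2 = n1.
Proof.
have [c2 [c1 [d' [f'_diag _]]]] := adapted_bases_exist f' b2 b1.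
apply/eqP; rewrite eqn_leq (diag_dim_leq f_fin f_diag).
by rewrite (diag_dim_leq inverse_isogeny_finite f'_diag).
Qed.

Lemma dvd_diag_last i : (i < n1)%N -> (d i %| e%:Z)%Z.
Proof.
move=> i1; have : (d i %| d n1.-1)%Z.
  by apply: d_chain; rewrite inverse_isogeny_dim -ltnS prednK // i1 leqnn.
by rewrite !dvdzE.
Qed.

Lemma inverse_diagE i : (i < n1)%N -> inverse_diag n1 d i * d (n1 - i.+1)%N = e%:Z.
Proof.
move=> i1; rewrite divzK // dvd_diag_last //.
by rewrite subnS prednK ?leq_subr // subn_gt0.
Qed.

(** Since [b2 j *~ d j] is [F (b1 j)], multiplying by [d j] reduces the claim
    to [F' (F (b1 j)) = b1 j *~ e]. *)
Lemma inverse_isogeny_image (j : 'I_n1) :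
  analytic_rep f' (b2 (widen_ord (diag_dim_leq f_fin f_diag) j)) =
  b1 j *~ (e%:Z %/ d j)%Z.
Proof.
have dj0 : d j != 0 := diag_neq0 f_fin f_diag (ltn_ord j).
have [_ _ f'fe] := ff'.
have dj0C : (d j)%:~R != 0 :> R[i]%C by rewrite intr_eq0.
apply: (scalerI dj0C); rewrite !scaler_int -raddfMz /=.
rewrite -(diag_basis_imageE f_fin f_diag) (analytic_rep_mulrn_comp f'fe).
rewrite -mulrzA divzK ?dvd_diag_last //.
by rewrite (diag_hom_exponent f_fin f_diag d_chain).
Qed.

Lemma inverse_isogeny_diag :
  exists (c2 : latticeBasis T2) (c1 : latticeBasis T1),
    rational_mx f' c2 c1 = rect_diag (inverse_diag n1 d) _ _.
Proof.
have [c2 c2E] := reversed_basis b2; have [c1 c1E] := reversed_basis b1.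
exists c2, c1; apply: rational_mx_unique => j; rewrite c2E.
have jn1 : (rev_ord j < n1)%N by rewrite -[n1]inverse_isogeny_dim.
have jE : (n1 - (n2 - j.+1).+1)%N = j.
  by rewrite inverse_isogeny_dim subnS subKn // -[n1]inverse_isogeny_dim.
have -> : rev_ord j = widen_ord (diag_dim_leq f_fin f_diag) (Ordinal jn1).
  exact/val_inj.
rewrite inverse_isogeny_image (bigD1 (rev_ord (Ordinal jn1))) //= big1 => [|i ij].
  rewrite c1E rev_ordK addr0 mxE /= -/n1 -/n2 jE eqxx mulr1n /inverse_diag.
  suff <- : (n2 - j.+1)%N = (n1 - j.+1)%N by [].
  by rewrite inverse_isogeny_dim.
rewrite mxE; case: eqP => [ijE|_]; last by rewrite mulr0z.
by case/eqP: ij; apply/val_inj; rewrite /= -/n2 jE.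
Qed.

Lemma inverse_diag_chain i j :
  (i <= j < n1)%N -> (inverse_diag n1 d i %| inverse_diag n1 d j)%Z.
Proof.
case/andP => ij j1; have i1 := leq_ltn_trans ij j1.
have /dvdzP[q dE] : (d (n1 - j.+1)%N %| d (n1 - i.+1)%N)%Z.
  apply: d_chain; rewrite inverse_isogeny_dim leq_sub2l //=.
  by rewrite ltn_subrL n1_gt0.
have dj0 : d (n1 - j.+1)%N != 0.
  by apply: (diag_neq0 f_fin f_diag); rewrite ltn_subrL n1_gt0.
apply/dvdzP; exists q; apply: (mulIf dj0).
by rewrite inverse_diagE // mulrAC -dE mulrC inverse_diagE.
Qed.

(** The product of the matrices of [f] and [f'] is the scalar matrix of the
    exponent, which has full rank. *)
Lemma inverse_isogeny_rank (B1 : latticeBasis T1) (B2 : latticeBasis T2) :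
  hom_rank f' B2 B1 = n1.
Proof.
have [_ ff'e _] := ff'; set c := hom_exponent f in ff'e.
have c0 : c%:Z%:~R != 0 :> rat.
  by have [[c0 _] _] := hom_exponentP f_fin; rewrite intr_eq0 eqz_nat -lt0n.
have AA' : rational_mx f B1 B2 *m rational_mx f' B2 B1 = c%:Z%:M.
  apply/matrixP => i j.
  have FF' := analytic_rep_mulrn_comp ff'e (B2 j).
  rewrite (rational_mxP f' B2 B1) (analytic_rep_sum f B1 B2) in FF'.
  suff /(_ i) : (rational_mx f B1 B2 *m rational_mx f' B2 B1)^~ j =1
      (c%:Z%:M : 'M_n2)^~ j by [].
  apply: (zbasis_inj (lattice_basisP B2)).
  rewrite FF' (bigD1 j) //= big1 => [|k kj]; first by rewrite mxE eqxx addr0.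
  by rewrite mxE (negPf kj) mulr0z.
apply/eqP; rewrite -[n1]inverse_isogeny_dim eqn_leq rank_leq_col /=.
rewrite -{1}(mxrank1 rat n2) -(eqmx_scale _ c0) scalemx1 -(map_scalar_mx intr).
by rewrite -AA' map_mxM mxrankM_maxr.
Qed.

End InverseIsogeny.

(** * Exponent, degree and types *)

Theorem corollary8 (R : realType) (T1 T2 : complexTorus R) (f : torusHom T1 T2)
    (B1 : latticeBasis T1) (B2 : latticeBasis T2)
    (f_fin : has_finite_kernel f) (g1_ge1 : (1 <= torus_dim T1)%N) :
  [/\ hom_exponent f = hom_d f B1 B2 (2 * torus_dim T1),
      hom_degree f =
        (hom_exponent f * hom_delta f B1 B2 (2 * torus_dim T1 - 1))%N &
      forall (f' : torusHom T2 T1)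
             (B2' : latticeBasis T2) (B1' : latticeBasis T1),
        isogeny f -> inverse_isogeny f f' ->
        [seq d%:R : rat | d <- hom_type f' B2' B1'] =
          1 :: [seq (hom_d f B1 B2 (2 * torus_dim T1))%:R /
                    (hom_d f B1 B2 (2 * torus_dim T1 - k))%:R
               | k <- iota 1 (2 * torus_dim T1 - 1)] /\
        hom_exponent f = (hom_d f B1 B2 1 * hom_exponent f')%N].
Proof.
have [b1 [b2 [d [f_diag d_chain]]]] := adapted_bases_exist f B1 B2.
have {}d_chain i j : (i <= j < 2 * torus_dim T2)%N -> (d i %| d j)%Z.
  by case/andP => ij _; exact: d_chain.
have n1_gt0 : (0 < 2 * torus_dim T1)%N by rewrite muln_gt0.
have d_neq0 := diag_neq0 f_fin f_diag.
have deltaE := diag_hom_delta f_fin f_diag d_chain B1 B2.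
have dE := diag_hom_d f_fin f_diag d_chain B1 B2.
have eE := diag_hom_exponent f_fin f_diag d_chain n1_gt0.
have degE := diag_hom_degree f_fin f_diag.
have rankE := fun f' ff' => @inverse_isogeny_rank _ _ _ f f' b1 b2 d f_fin f_diag ff'.
set n := (2 * torus_dim T1)%N in n1_gt0 d_neq0 deltaE dE eE degE rankE *.
have dnE : hom_d f B1 B2 n = `|d n.-1|%N by rewrite -{1}(prednK n1_gt0) dE // prednK.
split; first by rewrite eE dnE.
  rewrite eE degE deltaE ?leq_subr // subn1.
  by case: n n1_gt0 {d_neq0 deltaE dE eE degE rankE dnE} => // m _;
    rewrite big_ord_recr mulnC.
move=> f' B2' B1' _ ff'.
have f'_fin := inverse_isogeny_finite ff'.
have dim := inverse_isogeny_dim f_fin f_diag ff'.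
have [c2 [c1 f'_diag]] := inverse_isogeny_diag f_fin f_diag d_chain n1_gt0 ff'.
have d'_chain := inverse_diag_chain f_fin f_diag d_chain n1_gt0 ff'.
have d'E := inverse_diagE f_fin f_diag d_chain n1_gt0 ff'.
have e'E := diag_hom_exponent f'_fin f'_diag d'_chain.
have hom_d'E := diag_hom_d f'_fin f'_diag d'_chain B2' B1'.
rewrite dim -/n in e'E hom_d'E d'E.
set d' := inverse_diag n d in f'_diag d'_chain d'E e'E hom_d'E.
have {}d'E k : (k < n)%N -> (`|d' k| * `|d (n - k.+1)|)%N = `|d n.-1|%N.
  by move=> kn; rewrite -abszM d'E.
split; last first.
  by rewrite eE e'E // dE // -(d'E n.-1) ?prednK // subnn mulnC.
rewrite /hom_type rankE // -map_comp.
have -> : iota 1 n = 1%N :: map S (iota 1 (n - 1)).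
  by rewrite -{1}(prednK n1_gt0) /= -(iotaDl 1 1) subn1.
rewrite /= -map_comp; congr (_ :: _).
  have := d'E 0%N n1_gt0; rewrite hom_d'E // subn1 -[RHS]mul1n => /eqP.
  by rewrite eqn_pmul2r ?absz_gt0 ?d_neq0 ?prednK // => /eqP ->.
apply/eq_in_map => k; rewrite mem_iota => /andP[k0 kn] /=.
have {}kn : (k < n)%N by rewrite -(subnKC n1_gt0).
rewrite hom_d'E // dnE -(d'E k) // -[(n - k)%N]prednK ?subn_gt0 // dE; last first.
  by rewrite prednK ?subn_gt0 // leq_subr.
rewrite -subnS natrM mulfK // pnatr_eq0 -lt0n absz_gt0 d_neq0 //.
by rewrite ltn_subrL n1_gt0.
Qed.
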